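(* Let $w_J>0$ and fix $\alpha_0\ge 0$. Let $$f_{\alpha_0}\in\arg\min_{f\in H^1(\Omega_T)}\left[\frac{w_J}{2}\|u(f)(\cdot,T)-u_d\|_{L^2(\Omega)}^2+\frac{\alpha_0}{2}\|f\|_{H^1(\Omega_T)}^2\right]$$ be a minimizer of the continuous weighted regularized problem, and define its optimal value by $$\mathcal{J}_{\alpha_0}^*=\frac{w_J}{2}\|u(f_{\alpha_0})(\cdot,T)-u_d\|_{L^2(\Omega)}^2+\frac{\alpha_0}{2}\|f_{\alpha_0}\|_{H^1(\Omega_T)}^2.$$ Let $(\theta^*,\eta^* )$ be a global minimizer over all network parameters of the total loss $\mathcal{L}(\theta,\eta)=\mathcal{L}_{\mathrm{int}}(\theta,\eta)+\mathcal{L}_{\mathrm{sb}}(\theta)+\mathcal{L}_{\mathrm{tb}}(\theta)+w_J\mathcal{L}_{\mathrm{target}}(\theta)+\alpha\mathcal{L}_{\mathrm{reg}}(\eta)$ with $\alpha=\alpha_0$, and let $(u_{\theta^*},f_{\eta^*})$ be the corresponding pair of networks. Let $0<\epsilon\le 1$ and let $C_{\mathrm{quad}}>0$ be a quadrature-accuracy constant independent of $\epsilon$. Suppose there is a comparison pair of networks $(u_{\tilde\theta},f_{\tilde\eta})$ (approximating $(u(f_{\alpha_0}),f_{\alpha_0})$) whose three constraint losses satisfy $$\mathcal{L}_{\mathrm{int}}(\tilde\theta,\tilde\eta)+\mathcal{L}_{\mathrm{sb}}(\tilde\theta)+\mathcal{L}_{\mathrm{tb}}(\tilde\theta)\le\epsilon,$$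 and whose sampled target and regularization terms approximate their continuous counterparts with total weighted error at most $C_{\mathrm{quad}}\sqrt{\epsilon}$, i.e. $$w_J\left|\mathcal{L}_{\mathrm{target}}(\tilde\theta)-\tfrac12\|u(f_{\alpha_0})(\cdot,T)-u_d\|_{L^2(\Omega)}^2\right|+\alpha_0\left|\mathcal{L}_{\mathrm{reg}}(\tilde\eta)-\tfrac12\|f_{\alpha_0}\|_{H^1(\Omega_T)}^2\right|\le C_{\mathrm{quad}}\sqrt{\epsilon}.$$ Then $$w_J\mathcal{L}_{\mathrm{target}}(\theta^* )+\alpha_0\mathcal{L}_{\mathrm{reg}}(\eta^* )\le\mathcal{J}_{\alpha_0}^*+C'\sqrt{\epsilon},$$ where $C'=C_{\mathrm{quad}}+1$ is independent of $\epsilon$.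
   Context: Setting. $\Omega\subset\mathbb{R}^d$ is a bounded domain with smooth boundary, $T>0$, $\Omega_T=\Omega\times(0,T)$, $\Sigma_T=\partial\Omega\times(0,T)$. The state $u$ driven by a distributed control $f\in H^1(\Omega_T)$ solves $$\partial_t u+\mathcal{F}[u]=f\ \text{in }\Omega_T,\qquad \mathcal{B}[u]=0\ \text{on }\Sigma_T,\qquad u(\cdot,0)=u_0\ \text{in }\Omega,$$ where $\mathcal{F}$ is a (possibly nonlinear) spatial differential operator, $\mathcal{B}$ encodes homogeneous boundary conditions and $u_0\in L^2(\Omega)$. Let $V\subset H^1(\Omega)$ be the energy space incorporating the boundary condition, densely and continuously embedded in $L^2(\Omega)$, and let $W(0,T;V)=\{v\in L^2(0,T;V):\partial_t v\in L^2(0,T;V^* )\}\hookrightarrow C([0,T];L^2(\Omega))$. It is assumed that for every $f\in H^1(\Omega_T)$ the problem has a unique weak solution $u(f)=u_f\in W(0,T;V)$, so $u(f)(\cdot,T)\in L^2(\Omega)$ is well defined. The target is $u_d\in L^2(\Omega)$. Networks. $u_\theta$ and $f_\eta$ are independent fully connected feedforward neural networks with $\tanh$ activation and input $(x,t)\in\mathbb{R}^{d+1}$, with parameters $\theta\in\mathbb{R}^{p_u}$, $\eta\in\mathbb{R}^{p_f}$. Sampled losses. Fix finite sets of sample points $(x_i^{\mathrm{int}},t_i^{\mathrm{int}})\in\Omega_T$ ($1\le i\le N_{\mathrm{int}}$), $(x_i^{\mathrm{sb}},t_i^{\mathrm{sb}})\in\Sigma_T$ ($1\le i\le N_{\mathrm{sb}}$),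 $x_i^{\mathrm{tb}}\in\Omega$ ($1\le i\le N_{\mathrm{tb}}$), $x_i^{\mathrm{d}}\in\Omega$ ($1\le i\le N_d$), $(x_i^{\mathrm{reg}},t_i^{\mathrm{reg}})\in\Omega_T$ ($1\le i\le N_{\mathrm{reg}}$). Define $$\mathcal{L}_{\mathrm{int}}(\theta,\eta)=\frac1{N_{\mathrm{int}}}\sum_i\left|\partial_tu_\theta+\mathcal{F}[u_\theta]-f_\eta\right|^2(x_i^{\mathrm{int}},t_i^{\mathrm{int}}),\quad \mathcal{L}_{\mathrm{sb}}(\theta)=\frac1{N_{\mathrm{sb}}}\sum_i\left|\mathcal{B}[u_\theta](x_i^{\mathrm{sb}},t_i^{\mathrm{sb}})\right|^2,$$ $$\mathcal{L}_{\mathrm{tb}}(\theta)=\frac1{N_{\mathrm{tb}}}\sum_i\left|u_\theta(x_i^{\mathrm{tb}},0)-u_0(x_i^{\mathrm{tb}})\right|^2,\quad \mathcal{L}_{\mathrm{target}}(\theta)=\frac1{2N_d}\sum_i\left|u_\theta(x_i^{\mathrm d},T)-u_d(x_i^{\mathrm d})\right|^2,$$ $$\mathcal{L}_{\mathrm{reg}}(\eta)=\frac1{2N_{\mathrm{reg}}}\sum_i\left[|f_\eta|^2+|\nabla_{x,t}f_\eta|^2\right](x_i^{\mathrm{reg}},t_i^{\mathrm{reg}}),$$ where $\nabla_{x,t}$ is the gradient in all space-time variables. The first three are called the constraint losses. *)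

(* Defs.v *)
From HB Require Import structures.
From mathcomp Require Import all_boot all_order all_algebra.
From mathcomp Require Import all_classical all_reals all_analysis.

Set Implicit Arguments.
Unset Strict Implicit.
Unset Printing Implicit Defensive.

Import Order.TTheory GRing.Theory Num.Theory.
Import numFieldNormedType.Exports.

Local Open Scope classical_set_scope.
Local Open Scope ring_scope.

(* R^n is the type 'rV[R]_n, with the sigma-algebra generated by the
   coordinates (the Borel one, since the topology of 'rV[R]_n is the product
   topology).  The Lebesgue measure is built by transporting the product
   measure of R * R^n along (x, y) |-> (x, y_0, ..., y_(n-1)). *)

Definition rV_display : measure_display. Proof. exact: default_measure_display. Qed.

Section measurable_rV.
Context (R : realType) (n : nat).

Definition rV_coord (i : 'I_n) (x : 'rV[R]_n) : measurableTypeR R := x ord0 i.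

Let rV_set0 : g_sigma_preimage rV_coord set0.
Proof. exact: sigma_algebra0. Qed.

Let rV_setC A : g_sigma_preimage rV_coord A ->
  g_sigma_preimage rV_coord (~` A).
Proof. exact: sigma_algebraC. Qed.

Let rV_bigcup (F : (set 'rV[R]_n)^nat) :
  (forall i, g_sigma_preimage rV_coord (F i)) ->
  g_sigma_preimage rV_coord (\bigcup_i (F i)).
Proof. exact: sigma_algebra_bigcup. Qed.

HB.instance Definition _ := @isMeasurable.Build rV_display
  'rV[R]_n (g_sigma_preimage rV_coord) rV_set0 rV_setC rV_bigcup.

Lemma measurable_rV_coord (i : 'I_n) : measurable_fun [set: 'rV[R]_n] (rV_coord i).
Proof.
move=> _ Y mY; rewrite setTI; apply: sub_sigma_algebra => /=.
rewrite -bigcup_seq/=; exists i => /=; first by rewrite mem_index_enum.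
by exists Y => //; rewrite setTI.
Qed.

Lemma measurable_fun_rV d (T : measurableType d) (f : T -> 'rV[R]_n) :
  (forall i, measurable_fun [set: T] (rV_coord i \o f)) ->
  measurable_fun [set: T] f.
Proof.
move=> mf _ A mA.
have: preimage_set_system [set: T] f (g_sigma_preimage rV_coord) (f @^-1` A).
  by exists A => //; rewrite setTI.
rewrite -g_sigma_preimage_comp setTI => h.
apply: (smallest_sub _ _ h); first exact: sigma_algebra_measurable.
rewrite -bigcup_seq/=; apply: bigcup_sub => i _ _ [B mB <-].
exact: mf.
Qed.

End measurable_rV.

Section lebesgue_rV.
Context (R : realType).

Definition consrV n (p : measurableTypeR R * 'rV[R]_n) : 'rV[R]_(n.+1) :=
  \row_i oapp (fun j => p.2 ord0 j) p.1 (unlift ord0 i).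

Definition unconsrV n (x : 'rV[R]_(n.+1)) : measurableTypeR R * 'rV[R]_n :=
  (x ord0 ord0, \row_i x ord0 (lift ord0 i)).

Lemma consrVK n : cancel (@consrV n) (@unconsrV n).
Proof.
move=> [x y]; rewrite /unconsrV /consrV mxE unlift_none /=; congr pair.
by apply/rowP => i; rewrite !mxE liftK.
Qed.

Lemma measurable_consrV n : measurable_fun setT (@consrV n).
Proof.
apply: measurable_fun_rV => i.
case: (unliftP ord0 i) => [j|] ->.
- rewrite (_ : _ \o _ = rV_coord j \o snd); last first.
    by apply/funext => p; rewrite /rV_coord /= mxE liftK.
  by apply: measurableT_comp => //; exact: measurable_rV_coord.
- rewrite (_ : _ \o _ = fst) //.
  by apply/funext => p; rewrite /rV_coord /= mxE unlift_none.
Qed.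

Lemma measurable_unconsrV n : measurable_fun setT (@unconsrV n).
Proof.
apply/measurable_fun_pairP; split.
  exact: (measurable_rV_coord (R := R) (n := n.+1) ord0).
apply: measurable_fun_rV => i.
rewrite (_ : _ \o _ = rV_coord (lift ord0 i)); first exact: measurable_rV_coord.
by apply/funext => x; rewrite /rV_coord /= mxE.
Qed.

Section step.
Variables (n : nat) (mu : {sigma_finite_measure set 'rV[R]_n -> \bar R}).

Definition lebesgue_step : set 'rV[R]_n.+1 -> \bar R :=
  pushforward (lebesgue_measure \x mu)%E (@consrV n).

Let measurable_pre A : measurable A -> measurable (@consrV n @^-1` A).
Proof. by move=> mA; rewrite -[X in measurable X]setTI; exact: measurable_consrV. Qed.

Let step0 : lebesgue_step set0 = 0%E.
Proof. by rewrite /lebesgue_step /pushforward preimage_set0 measure0. Qed.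

Let step_ge0 A : (0 <= lebesgue_step A)%E.
Proof. by rewrite /lebesgue_step /pushforward; exact: measure_ge0. Qed.

Let step_sigma_additive : semi_sigma_additive lebesgue_step.
Proof.
move=> F mF tF mUF; rewrite /lebesgue_step /pushforward preimage_bigcup.
apply: measure_semi_sigma_additive.
- by move=> k; exact: measurable_pre.
- apply/trivIsetP => /= i j _ _ ij; rewrite -preimage_setI.
  by move/trivIsetP : tF => /(_ _ _ _ _ ij) ->//; rewrite preimage_set0.
- by rewrite -preimage_bigcup; exact: measurable_pre.
Qed.

HB.instance Definition _ := isMeasure.Build _ _ _ lebesgue_step
  step0 step_ge0 step_sigma_additive.

Let step_sigma_finite : sigma_finite setT lebesgue_step.
Proof.
have /sigma_finiteP[F [TF ndF Foo]] := sigma_finiteT (@lebesgue_measure R).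
have /sigma_finiteP[G [TG ndG Goo]] := sigma_finiteT mu.
exists (fun k => @unconsrV n @^-1` (F k `*` G k)).
  rewrite -preimage_bigcup; apply/esym/seteqP; split=> // x _.
  have [i _ Fi] : (\bigcup_k F k) (unconsrV x).1 by rewrite -TF.
  have [j _ Gj] : (\bigcup_k G k) (unconsrV x).2 by rewrite -TG.
  exists (maxn i j) => //; split.
    by move: Fi; exact/subsetPset/ndF/leq_maxl.
  by move: Gj; exact/subsetPset/ndG/leq_maxr.
move=> k; have [mF Fk] := Foo k; have [mG Gk] := Goo k; split.
  rewrite -[X in measurable X]setTI.
  by apply: measurable_unconsrV => //; exact: measurableX.
rewrite /lebesgue_step /pushforward -comp_preimage.
rewrite (_ : _ \o _ = id); last by apply/funext => p; exact: consrVK.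
rewrite preimage_id product_measure1E//.
by rewrite lte_mul_pinfty// ge0_fin_numE.
Qed.

HB.instance Definition _ := Measure_isSigmaFinite.Build _ _ _ lebesgue_step
  step_sigma_finite.

End step.

Fixpoint lebesgue_rV n : {sigma_finite_measure set 'rV[R]_n -> \bar R} :=
  if n is n'.+1 then lebesgue_step (lebesgue_rV n')
  else dirac (0 : 'rV[R]_0).

End lebesgue_rV.

Section smooth.
Context {R : realType} {n : nat}.
Implicit Types (f : 'rV[R]_n -> R) (O : set 'rV[R]_n).

Definition pderiv (i : 'I_n) f (x : 'rV[R]_n) : R := 'D_(delta_mx 0 i) f x.

Definition pderivs (s : seq 'I_n) f : 'rV[R]_n -> R := foldr pderiv f s.

(* Differentiability of all iterated partial derivatives: this is C^oo on O
   when O is open. *)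
Definition smooth_on O f :=
  forall (s : seq 'I_n) x, O x -> differentiable (pderivs s f) x.

Definition test_fun O f :=
  [/\ smooth_on setT f, compact (closure [set x | f x != 0])
    & closure [set x | f x != 0] `<=` O].

Definition boundary O : set 'rV[R]_n := closure O `\` O°.

(* Near each boundary point, O is a strict sublevel set of a smooth function
   without critical point. *)
Definition smooth_boundary O :=
  forall x, boundary O x -> exists (U : set 'rV[R]_n) (rho : 'rV[R]_n -> R),
    [/\ open U, U x, smooth_on U rho,
        forall y, U y -> exists i, pderiv i rho y != 0
      & forall y, U y -> (O y <-> rho y < 0)].

Definition smooth_bounded_domain O :=
  [/\ O !=set0, open O, connected O, bounded_set O & smooth_boundary O].

End smooth.

(* Elements of L^2 and H^1 are represented by functions, equality being
   [ae_eq]. *)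

Section sobolev.
Context {R : realType} {n : nat}.
Implicit Types (f g : 'rV[R]_n -> R) (O : set 'rV[R]_n).
Local Notation mu := (lebesgue_rV R n).

(* [Lfun] asks for Borel functions; going through an a.e. equal function also
   allows Lebesgue measurable ones. *)
Definition L2 O f :=
  exists2 g, g \in Lfun mu 2%:E & ae_eq mu O f g.

Definition L2dot O f g : R := \int[mu]_(x in O) (f x * g x).

Definition L2norm O f : R := fine ('N[mu]_2%:E [EFin \o (f \_ O)]).

Definition weak_pderiv O (i : 'I_n) f g :=
  forall phi, test_fun O phi ->
    \int[mu]_(x in O) (f x * pderiv i phi x) =
    - \int[mu]_(x in O) (g x * phi x).

Definition H1 O f :=
  L2 O f /\ forall i, exists g, L2 O g /\ weak_pderiv O i f g.

Definition wpderiv O (i : 'I_n) f : 'rV[R]_n -> R :=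
  xget (fun=> 0) [set g | L2 O g /\ weak_pderiv O i f g].

Definition H1norm O f : R :=
  Num.sqrt (L2norm O f ^+ 2 + \sum_(i < n) L2norm O (wpderiv O i f) ^+ 2).

(* A Banach space V of (classes of) functions, for the norm nV, included in
   H^1(O), and continuously and densely included in L^2(O). *)
Record energy_space O (V : set ('rV[R]_n -> R)) (nV : ('rV[R]_n -> R) -> R) :
    Prop := EnergySpace {
  energy_H1 : V `<=` H1 O ;
  energy_ae : forall v w, V v -> ae_eq mu O v w -> V w /\ nV w = nV v ;
  energy_0 : V (fun=> 0) ;
  energy_lin : forall (a : R) v w, V v -> V w -> V (fun x => a * v x + w x) ;
  energy_ge0 : forall v, V v -> 0 <= nV v ;
  energy_Z : forall (a : R) v, V v -> nV (fun x => a * v x) = `|a| * nV v ;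
  energy_D : forall v w, V v -> V w -> nV (v + w) <= nV v + nV w ;
  energy_complete : forall v : ('rV[R]_n -> R)^nat, (forall k, V (v k)) ->
    (forall e : R, 0 < e -> exists N : nat, forall k l : nat,
       (N <= k)%N -> (N <= l)%N -> nV (v k - v l) < e) ->
    exists2 w, V w & nV (v k - w) @[k --> \oo] --> (0 : R) ;
  energy_L2 : exists C : R, forall v, V v -> L2norm O v <= C * nV v ;
  energy_dense : forall w (e : R), L2 O w -> 0 < e ->
    exists2 v, V v & L2norm O (w - v) < e
}.

Definition dual (V : set ('rV[R]_n -> R)) (nV : ('rV[R]_n -> R) -> R) :
    set (('rV[R]_n -> R) -> R) :=
  [set l | (forall (a : R) v w, V v -> V w ->
              l (fun x => a * v x + w x) = a * l v + l w) /\
           exists C : R, forall v, V v -> `|l v| <= C * nV v].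

Definition dual_norm (V : set ('rV[R]_n -> R)) (nV : ('rV[R]_n -> R) -> R)
    (l : ('rV[R]_n -> R) -> R) : R :=
  sup [set `|l v| | v in [set v | V v /\ nV v <= 1]].

End sobolev.

Section bochner.
Context {R : realType}.
Local Notation leb := (@lebesgue_measure R).

(* The square integrable functions g from I to the subspace C of X, normed by
   nrm: limits a.e. of simple functions, with \int_I |g(t)|^2 dt finite. *)
Definition bochner_L2 (X : zmodType) (C : set X) (nrm : X -> R) (I : set R)
    (g : R -> X) :=
  [/\ \forall t \ae leb, I t -> C (g t),
      exists s : nat -> R -> X,
        (forall k, [/\ finite_set (range (s k)), range (s k) `<=` C
                     & forall x, measurable (s k @^-1` [set x])]) /\
        \forall t \ae leb, I t ->
          nrm (s k t - g t) @[k --> \oo] --> (0 : R)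
    & (\int[leb]_(t in I) (nrm (g t) ^+ 2)%:E < +oo)%E].

Definition time_test_fun (T : R) (psi : R -> R) :=
  [/\ forall k t, derivable (derive1n k psi) t 1,
      compact (closure [set t | psi t != 0])
    & closure [set t | psi t != 0] `<=` `]0, T[].

End bochner.

Section time_space.
Context {R : realType} {d : nat}.
Variables (Om : set 'rV[R]_d) (T : R).
Variables (V : set ('rV[R]_d -> R)) (nV : ('rV[R]_d -> R) -> R).
Local Notation leb := (@lebesgue_measure R).

(* u belongs to W(0,T;V) and du is its time derivative, L^2(Om) being embedded
   in V^* by its inner product.  u is required to be the representative which
   is in C([0,T]; L^2(Om)), so that u(0) and u(T) make sense. *)
Definition in_W (u : R -> 'rV[R]_d -> R) (du : R -> ('rV[R]_d -> R) -> R) :=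
  [/\ forall t, 0 <= t <= T -> L2 Om (u t),
      forall t, 0 <= t <= T ->
        L2norm Om (u s - u t) @[s --> within `[0, T] (nbhs t)] --> (0 : R),
      bochner_L2 V nV `]0, T[ u,
      bochner_L2 (dual V nV) (dual_norm V nV) `]0, T[ du
    & forall v psi, V v -> time_test_fun T psi ->
        \int[leb]_(t in `]0, T[) (L2dot Om (u t) v * derive1 psi t) =
        - \int[leb]_(t in `]0, T[) (du t v * psi t)].

End time_space.

(* Space-time points are the vectors (x_1, ..., x_d, t) of R^(d+1). *)

Section spacetime.
Context {R : realType} {d : nat}.

Definition st (x : 'rV[R]_d) (t : R) : 'rV[R]_(d + 1) :=
  row_mx x (const_mx t).

Definition cylinder (Om : set 'rV[R]_d) (T : R) : set 'rV[R]_(d + 1) :=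
  [set z | Om (lsubmx z) /\ 0 < rsubmx z ord0 ord0 < T].

Definition dt (u : 'rV[R]_(d + 1) -> R) : 'rV[R]_(d + 1) -> R :=
  pderiv (rshift d ord0) u.

(* A spatial differential operator of order m, with values in Y, maps v to a
   function of (x, t) and of the partial derivatives of v of order at most m
   at x; s : {bseq m of 'I_d} stands for the derivative along s_0, s_1, ... *)
Definition diffop (m : nat) (Y : Type) :=
  'rV[R]_d -> R -> ({bseq m of 'I_d} -> R) -> Y.

Definition apply_op m Y (A : diffop m Y) (v : 'rV[R]_d -> R) x t : Y :=
  A x t (fun s => pderivs s v x).

Definition apply_op_st m Y (A : diffop m Y) (u : 'rV[R]_(d + 1) -> R) x t : Y :=
  apply_op A (fun y => u (st y t)) x t.

End spacetime.
Arguments diffop : clear implicits.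

(* B may gather several scalar boundary conditions. *)
Record control_problem (R : realType) (d : nat) := ControlProblem {
  dom : set 'rV[R]_d ;
  horizon : R ;
  ordF : nat ;
  opF : diffop R d ordF R ;
  ordB : nat ;
  dimB : nat ;
  opB : diffop R d ordB 'rV[R]_dimB ;
  init : 'rV[R]_d -> R ;
  target : 'rV[R]_d -> R
}.
Arguments opF {R d} _.
Arguments opB {R d} _.

Section problem.
Context {R : realType} {d : nat}.
Variable P : control_problem R d.
Variables (V : set ('rV[R]_d -> R)) (nV : ('rV[R]_d -> R) -> R).
Local Notation Om := (dom P).
Local Notation T := (horizon P).
Local Notation mu := (lebesgue_rV R d).

(* a(t; v, phi) is the pairing of F[v] at time t with phi.  It agrees with the
   strong formulation on smooth functions: these satisfy the boundary condition
   iff they are in V and a(t; v, phi) is the L^2 inner product of F[v] and phi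
   for all phi in V (essential and natural conditions are both covered).
   Linearity and continuity of a in phi are not imposed: for solutions they
   follow from the equation in [weak_solution], and elsewhere F[v] need not
   define an element of V^*. *)
Definition weak_form (a : R -> ('rV[R]_d -> R) -> ('rV[R]_d -> R) -> R) :=
  (forall t v w phi psi, 0 < t < T -> V v -> V phi ->
     ae_eq mu Om v w -> ae_eq mu Om phi psi -> a t v phi = a t w psi) /\
  (forall t v, 0 < t < T -> smooth_on setT v ->
     L2 Om (fun x => apply_op (opF P) v x t) ->
     (forall x, boundary Om x -> apply_op (opB P) v x t = 0) <->
     (V v /\ forall phi, V phi ->
        a t v phi = L2dot Om (fun x => apply_op (opF P) v x t) phi)).

Variable a : R -> ('rV[R]_d -> R) -> ('rV[R]_d -> R) -> R.

Definition weak_solution (f : 'rV[R]_(d + 1) -> R) (u : R -> 'rV[R]_d -> R) :=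
  exists du, [/\ in_W Om T V nV u du,
    ae_eq mu Om (u 0) (init P)
  & \forall t \ae (@lebesgue_measure R), 0 < t < T -> forall phi, V phi ->
      du t phi + a t (u t) phi = L2dot Om (fun x => f (st x t)) phi].

Definition solution_map (sol : ('rV[R]_(d + 1) -> R) -> R -> 'rV[R]_d -> R) :=
  forall f, H1 (cylinder Om T) f -> weak_solution f (sol f) /\
    forall u, weak_solution f u ->
      forall t, 0 <= t <= T -> ae_eq mu Om (u t) (sol f t).

Variable sol : ('rV[R]_(d + 1) -> R) -> R -> 'rV[R]_d -> R.

Definition objective (wJ alpha : R) (f : 'rV[R]_(d + 1) -> R) : R :=
  wJ / 2 * L2norm Om (sol f T - target P) ^+ 2
  + alpha / 2 * H1norm (cylinder Om T) f ^+ 2.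

Definition is_minimizer (wJ alpha : R) (f0 : 'rV[R]_(d + 1) -> R) :=
  H1 (cylinder Om T) f0 /\
  forall f, H1 (cylinder Om T) f -> objective wJ alpha f0 <= objective wJ alpha f.

End problem.

Section network.
Context {R : realType}.

Definition tanh (x : R) : R := (expR x - expR (- x)) / (expR x + expR (- x)).

(* Number of parameters of the fully connected network with n inputs, hidden
   layers of widths ws, and one output. *)
Fixpoint nparams (n : nat) (ws : seq nat) : nat :=
  if ws is m :: ws' then ((m * n + m) + nparams m ws')%N else (n + 1)%N.

(* Each hidden layer is y |-> tanh (y W^T + b), the output layer is affine. *)
Fixpoint network (n : nat) (ws : seq nat) :
    'rV[R]_(nparams n ws) -> 'rV[R]_n -> R :=
  match ws return 'rV[R]_(nparams n ws) -> 'rV[R]_n -> R with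
  | [::] => fun theta y =>
      (y *m (lsubmx theta)^T) ord0 ord0 + rsubmx theta ord0 ord0
  | m :: ws' => fun theta y =>
      let W : 'M[R]_(m, n) := vec_mx (lsubmx (lsubmx theta)) in
      let b : 'rV[R]_m := rsubmx (lsubmx theta) in
      network (rsubmx theta) (map_mx tanh (y *m W^T + b))
  end.

End network.

Record samples (R : realType) (d : nat) (Om : set 'rV[R]_d) (T : R) := Samples {
  n_int : nat ; x_int : 'I_n_int -> 'rV[R]_d ; t_int : 'I_n_int -> R ;
  n_sb : nat ; x_sb : 'I_n_sb -> 'rV[R]_d ; t_sb : 'I_n_sb -> R ;
  n_tb : nat ; x_tb : 'I_n_tb -> 'rV[R]_d ;
  n_d : nat ; x_d : 'I_n_d -> 'rV[R]_d ;
  n_reg : nat ; x_reg : 'I_n_reg -> 'rV[R]_d ; t_reg : 'I_n_reg -> R ;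
  n_int_gt0 : (0 < n_int)%N ;
  n_sb_gt0 : (0 < n_sb)%N ;
  n_tb_gt0 : (0 < n_tb)%N ;
  n_d_gt0 : (0 < n_d)%N ;
  n_reg_gt0 : (0 < n_reg)%N ;
  int_in : forall i, Om (x_int i) /\ 0 < t_int i < T ;
  sb_in : forall i, boundary Om (x_sb i) /\ 0 < t_sb i < T ;
  tb_in : forall i, Om (x_tb i) ;
  d_in : forall i, Om (x_d i) ;
  reg_in : forall i, Om (x_reg i) /\ 0 < t_reg i < T
}.
Arguments x_int {R d Om T} _.
Arguments t_int {R d Om T} _.
Arguments x_sb {R d Om T} _.
Arguments t_sb {R d Om T} _.
Arguments x_tb {R d Om T} _.
Arguments x_d {R d Om T} _.
Arguments x_reg {R d Om T} _.
Arguments t_reg {R d Om T} _.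

Section losses.
Context {R : realType} {d : nat}.
Variable P : control_problem R d.
Variable S : samples (dom P) (horizon P).
Implicit Types u f : 'rV[R]_(d + 1) -> R.

Definition loss_int u f : R := (n_int S)%:R^-1 * \sum_i
  (dt u (st (x_int S i) (t_int S i))
   + apply_op_st (opF P) u (x_int S i) (t_int S i)
   - f (st (x_int S i) (t_int S i))) ^+ 2.

Definition loss_sb u : R := (n_sb S)%:R^-1 * \sum_i
  \sum_(j < dimB P) (apply_op_st (opB P) u (x_sb S i) (t_sb S i) ord0 j) ^+ 2.

Definition loss_tb u : R := (n_tb S)%:R^-1 * \sum_i
  (u (st (x_tb S i) 0) - init P (x_tb S i)) ^+ 2.

Definition loss_target u : R := (2 * (n_d S)%:R)^-1 * \sum_i
  (u (st (x_d S i) (horizon P)) - target P (x_d S i)) ^+ 2.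

Definition loss_reg f : R := (2 * (n_reg S)%:R)^-1 * \sum_i
  (f (st (x_reg S i) (t_reg S i)) ^+ 2
   + \sum_(k < d + 1) (pderiv k f (st (x_reg S i) (t_reg S i))) ^+ 2).

Definition total_loss (wJ alpha : R) u f : R :=
  loss_int u f + loss_sb u + loss_tb u
  + wJ * loss_target u + alpha * loss_reg f.

End losses.

(* Main.v *)
(* The comparison pair bounds the minimal total loss. The constraint losses are
   nonnegative, so they can be dropped at the optimum, while at the comparison
   pair they cost at most eps <= sqrt eps. *)

Require Import Defs.
From mathcomp Require Import all_boot all_order all_algebra.
From mathcomp Require Import all_classical all_reals all_analysis.
From mathcomp Require Import lra.

Set Implicit Arguments.
Unset Strict Implicit.
Unset Printing Implicit Defensive.

Import Order.TTheory GRing.Theory Num.Theory.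

Local Open Scope classical_set_scope.
Local Open Scope ring_scope.

Lemma loss_int_ge0 (R : realType) (d : nat) (P : control_problem R d)
  (S : samples (dom P) (horizon P)) (u f : 'rV[R]_(d + 1) -> R) :
  0 <= loss_int S u f.
Proof.
by rewrite mulr_ge0 ?invr_ge0 ?ler0n// sumr_ge0// => i _; rewrite sqr_ge0.
Qed.

Lemma loss_sb_ge0 (R : realType) (d : nat) (P : control_problem R d)
  (S : samples (dom P) (horizon P)) (u : 'rV[R]_(d + 1) -> R) :
  0 <= loss_sb S u.
Proof.
rewrite mulr_ge0 ?invr_ge0 ?ler0n// sumr_ge0// => i _.
by rewrite sumr_ge0// => j _; rewrite sqr_ge0.
Qed.

Lemma loss_tb_ge0 (R : realType) (d : nat) (P : control_problem R d)
  (S : samples (dom P) (horizon P)) (u : 'rV[R]_(d + 1) -> R) :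
  0 <= loss_tb S u.
Proof.
by rewrite mulr_ge0 ?invr_ge0 ?ler0n// sumr_ge0// => i _; rewrite sqr_ge0.
Qed.

(** Write [x] as the square of its root; one of the two factors is at most [Num.sqrt 1 = 1]. This
    brings the constraint tolerance [eps] to the order [Num.sqrt eps] of the quadrature error. *)
Lemma le_sqrt_unit (R : rcfType) (x : R) : 0 <= x -> x <= 1 -> x <= Num.sqrt x.
Proof.
move=> x_ge0 x_le1; rewrite -{1}(sqr_sqrtr x_ge0) expr2.
by rewrite ler_piMr ?sqrtr_ge0// -sqrtr1 ler_wsqrtr.
Qed.

Theorem proposition4p1 (R : realType) (d : nat) (d_gt0 : (0 < d)%N)
  (P : control_problem R d)
  (Om_dom : smooth_bounded_domain (dom P))
  (T_gt0 : 0 < horizon P)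
  (init_L2 : L2 (dom P) (init P))
  (target_L2 : L2 (dom P) (target P))
  (V : set ('rV[R]_d -> R)) (nV : ('rV[R]_d -> R) -> R)
  (V_energy : energy_space (dom P) V nV)
  (a : R -> ('rV[R]_d -> R) -> ('rV[R]_d -> R) -> R)
  (a_weak : weak_form P V a)
  (sol : ('rV[R]_(d + 1) -> R) -> R -> 'rV[R]_d -> R)
  (sol_weak : solution_map P V nV a sol)
  (widths_u widths_f : seq nat)
  (S : samples (dom P) (horizon P))
  (wJ alpha0 : R) (wJ_gt0 : 0 < wJ) (alpha0_ge0 : 0 <= alpha0)
  (f0 : 'rV[R]_(d + 1) -> R)
  (f0_min : is_minimizer P sol wJ alpha0 f0)
  (theta_opt : 'rV[R]_(nparams (d + 1) widths_u))
  (eta_opt : 'rV[R]_(nparams (d + 1) widths_f))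
  (global_min : forall (theta : 'rV[R]_(nparams (d + 1) widths_u))
                       (eta : 'rV[R]_(nparams (d + 1) widths_f)),
     total_loss S wJ alpha0 (network theta_opt) (network eta_opt) <=
     total_loss S wJ alpha0 (network theta) (network eta))
  (Cquad : R) (Cquad_gt0 : 0 < Cquad)
  (eps : R) (eps_gt0 : 0 < eps) (eps_le1 : eps <= 1)
  (theta_cmp : 'rV[R]_(nparams (d + 1) widths_u))
  (eta_cmp : 'rV[R]_(nparams (d + 1) widths_f))
  (constraint_small :
     loss_int S (network theta_cmp) (network eta_cmp)
     + loss_sb S (network theta_cmp) + loss_tb S (network theta_cmp) <= eps)
  (quadrature :
     wJ * `|loss_target S (network theta_cmp)
            - 2^-1 * L2norm (dom P) (sol f0 (horizon P) - target P) ^+ 2|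
     + alpha0 * `|loss_reg S (network eta_cmp)
                  - 2^-1 * H1norm (cylinder (dom P) (horizon P)) f0 ^+ 2|
     <= Cquad * Num.sqrt eps) :
  wJ * loss_target S (network theta_opt) + alpha0 * loss_reg S (network eta_opt)
  <= objective P sol wJ alpha0 f0 + (Cquad + 1) * Num.sqrt eps.
Proof.
have int_ge0 := loss_int_ge0 S (network theta_opt) (network eta_opt).
have sb_ge0 := loss_sb_ge0 S (network theta_opt).
have tb_ge0 := loss_tb_ge0 S (network theta_opt).
have eps_sqrt := le_sqrt_unit (ltW eps_gt0) eps_le1.
(* Only the upper half of each two-sided quadrature estimate is used. The weight stays on the
   absolute value, so that the two error terms add up to the left-hand side of [quadrature]. *)
have weighted_le (w x y : R) : 0 <= w -> w * x <= w * y + w * `|x - y|.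
  by move=> w_ge0; rewrite -mulrDr ler_wpM2l// -lerBlDl ler_norm.
have target_le := weighted_le wJ (loss_target S (network theta_cmp))
  (2^-1 * L2norm (dom P) (sol f0 (horizon P) - target P) ^+ 2) (ltW wJ_gt0).
have reg_le := weighted_le alpha0 (loss_reg S (network eta_cmp))
  (2^-1 * H1norm (cylinder (dom P) (horizon P)) f0 ^+ 2) alpha0_ge0.
have := global_min theta_cmp eta_cmp.
(* Reassociation turns [wJ / 2 * _] into [wJ * (2^-1 * _)], and likewise for [alpha0], so that the
   products match those of [target_le] and [reg_le] and are atoms for [lra]. *)
rewrite /total_loss /objective -!mulrA mulrDl mul1r.
(* In the final constant, [Cquad] comes from [quadrature] and [1] from [constraint_small] followed
   by [eps_sqrt]. *)
lra.
Qed.
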